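(* Let $\mathbb{X}$ be a real normed space with $\dim \mathbb{X}\ge 2$. Let $u, v \in S_{\mathbb{X}}$ be such that $\min\{\|u-v\|, \|u+v\|\} = J(\mathbb{X})$. Then $u\perp_{I} v$.
   Context: $S_{\mathbb{X}}=\{x\in\mathbb{X}:\|x\|=1\}$ is the unit sphere of $\mathbb{X}$. The James constant is $J(\mathbb{X}) = \sup\{\min\{\|x+y\|, \|x-y\|\} : x, y \in S_{\mathbb{X}}\}$. Isosceles orthogonality: $x\perp_I y$ means $\|x+y\|=\|x-y\|$. *)

(* Defs.v *)
From HB Require Import structures.
From mathcomp Require Import all_boot all_order all_algebra.
From mathcomp Require Import all_classical all_reals all_analysis.

Set Implicit Arguments.
Unset Strict Implicit.
Unset Printing Implicit Defensive.

Import Order.TTheory GRing.Theory Num.Theory.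
Import numFieldNormedType.Exports.

Local Open Scope classical_set_scope.
Local Open Scope ring_scope.

(* [dim V >= n], also meaningful for infinite-dimensional [V]. *)
Definition dim_ge (R : realType) (V : lmodType R) (n : nat) : Prop :=
  exists e : 'I_n -> V,
    forall c : 'I_n -> R, \sum_(i < n) c i *: e i = 0 -> forall i, c i = 0.

Definition unit_sphere (R : realType) (X : normedModType R) : set X :=
  [set x | `|x| = 1].
Arguments unit_sphere {R} X.

(* [sup] is the junk value 0 on empty or unbounded sets; here the set is
   bounded by 2, and it is nonempty as soon as [X] is nontrivial. *)
Definition james_constant (R : realType) (X : normedModType R) : R :=
  sup [set Num.min `|x + y| `|x - y|
      | x in unit_sphere X & y in unit_sphere X].
Arguments james_constant {R} X.

Definition isosceles_orthogonal (R : realType) (X : normedModType R)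
    (x y : X) : Prop :=
  `|x + y| = `|x - y|.

(* Main.v *)
(* If [`|u - v| < `|u + v|], push [u] and [v] apart along the line through them,
   to [u + a (u - v)] and [v + b (v - u)] with small [a, b >= 0], not both 0,
   chosen so that both have the same norm [n].  By the triangle inequality
   [n <= 1 + `|u - v| (a + b) / 2 < 1 + a + b], since [`|u - v| < 2]; hence
   dividing by [n] gives unit vectors at distance
   [(1 + a + b) `|u - v| / n > `|u - v|], while the norm of their sum stays
   larger than [`|u - v|].  So [min (`|u - v|, `|u + v|)] was not maximal. *)
Require Import Defs.
From mathcomp Require Import all_boot all_order all_algebra.
From mathcomp Require Import all_classical all_reals all_analysis.
From mathcomp Require Import ring lra.

Import Order.TTheory GRing.Theory Num.Theory.
Import numFieldNormedType.Exports.

Local Open Scope classical_set_scope.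
Local Open Scope ring_scope.

Lemma min_le_james_constant (R : realType) (X : normedModType R) (x y : X) :
  `|x| = 1 -> `|y| = 1 -> Num.min `|x + y| `|x - y| <= james_constant X.
Proof.
move=> hx hy; apply: ub_le_sup; last by exists x => //; exists y.
exists 2 => _ [a ha [b hb <-]]; rewrite ge_min; apply/orP; left.
by rewrite (le_trans (ler_normD _ _))// ha hb.
Qed.

Lemma norm_normalize (R : realType) (X : normedModType R) (x : X) :
  x != 0 -> `|(`|x|^-1) *: x| = 1.
Proof. by move=> x0; rewrite normrZ normfV normr_id mulVf// normr_eq0. Qed.

(** Two independent vectors, once normalised, have nonzero sum and difference. Positivity keeps a
    maximal pair from coinciding, so that there is a line to push along. *)
Lemma james_constant_gt0 (R : realType) (X : normedModType R) :
  dim_ge X 2 -> 0 < james_constant X.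
Proof.
move=> [e free_e].
have indep a b : a *: e ord0 + b *: e ord_max = 0 -> a = 0 /\ b = 0.
  move=> ab; have := free_e (fun i => if i == ord0 then a else b).
  rewrite big_ord_recl big_ord1 /= => /(_ _) h.
  have {}h := h _; split.
    by have := h _ ord0; apply;
      rewrite -[RHS]ab; congr (_ + _ *: e _); apply/val_inj.
  by have := h _ ord_max; apply;
      rewrite -[RHS]ab; congr (_ + _ *: e _); apply/val_inj.
have e0 : e ord0 != 0.
  apply/eqP => e00; have [] := indep 1 0; last by move/eqP; rewrite oner_eq0.
  by rewrite e00 scaler0 scale0r addr0.
have e1 : e ord_max != 0.
  apply/eqP => e10; have [] := indep 0 1; last by move=> _ /eqP; rewrite oner_eq0.
  by rewrite e10 scaler0 scale0r addr0.
have := min_le_james_constant _ _ _ _ (norm_normalize _ _ _ e0)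
  (norm_normalize _ _ _ e1).
apply: lt_le_trans; rewrite lt_min !normr_gt0 -scaleNr.
by apply/andP; split; apply/eqP => /indep[/eqP];
  rewrite invr_eq0 normr_eq0 (negbTE e0).
Qed.

(** Convexity: [u] lies between [v] and the extended vector, so the norm cannot drop beyond the end
    where it is larger. *)
Lemma norm_le_norm_extend (R : realType) (X : normedModType R) (u v : X)
    (a : R) :
  `|v| <= `|u| -> 0 <= a -> `|u| <= `|u + a *: (u - v)|.
Proof.
move=> vu a0.
have : `|(1 + a) *: u| <= `|u + a *: (u - v)| + `|a *: v|.
  rewrite (_ : (1 + a) *: u = u + a *: (u - v) + a *: v) ?ler_normD//.
  by rewrite scalerBr addrA subrK scalerDl scale1r.
rewrite !normrZ !ger0_norm ?addr_ge0// mulrDl mul1r => h.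
by have := ler_wpM2l a0 vu; lra.
Qed.

Lemma norm_extend_le (R : realType) (X : normedModType R) (u w : X) (a : R) :
  0 <= a -> `|u + a *: w| <= `|u| + a * `|w|.
Proof.
by move=> a0; rewrite (le_trans (ler_normD _ _))// normrZ (ger0_norm a0).
Qed.

Lemma continuous_norm_extend (R : realType) (X : normedModType R) (u w : X) :
  continuous (fun a : R => `|u + a *: w|).
Proof.
move=> a; apply: cvg_norm; apply: cvgD; first exact: cvg_cst.
by apply: cvgZr_tmp; exact: cvg_id.
Qed.

Lemma spread_unit_vectors (R : realType) (X : normedModType R) (u v : X) :
  `|u| = 1 -> `|v| = 1 -> 0 < `|u - v| < `|u + v| ->
  exists x y : X, [/\ `|x| = 1, `|y| = 1 &
    `|u - v| < Num.min `|x + y| `|x - y|].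
Proof.
(* Any divisor above 6 works: the norm of the sum loses at most [2 * d], and multiplying [J] by [n]
   adds at most [4 * d]. *)
set d := (`|u + v| - `|u - v|) / 7.
(* Exchanging [u] and [v] preserves [d] and the conclusion; [u] becomes the vector whose full push
   has the smaller norm. *)
wlog guv : u v @d / `|u + d *: (u - v)| <= `|v + d *: (v - u)|.
  move=> spread hu hv huv.
  have [|/ltW] := leP `|u + d *: (u - v)| `|v + d *: (v - u)|.
    by move=> /spread; exact.
  rewrite /d (distrC u v) (addrC u v) => /spread.
  by rewrite (distrC v u) (addrC v u); exact.
move=> hu hv /andP[uv0 uv].
(* Here [J] is just this distance, not yet the James constant. *)
set J := `|u - v| in uv0 uv *.
have uvJ : `|u - v| = J by [].
have vuJ : `|v - u| = J by rewrite distrC.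
have J2 : J < 2.
  by rewrite (lt_le_trans uv)// (le_trans (ler_normD _ _))// hu hv.
have d0 : 0 < d by rewrite /d divr_gt0// subr_gt0.
have dE : `|u + v| = J + 7 * d by rewrite /d uvJ; field.
pose n := `|u + d *: (u - v)|.
have n1 : 1 <= n.
  by rewrite -[leLHS]hu norm_le_norm_extend ?hu ?hv// ltW.
have nd : n <= 1 + d * J.
  by rewrite -[X in _ <= X + _]hu -uvJ norm_extend_le// ltW.
(* Pushing [v] by 0 gives norm [1 <= n], and by [d] gives norm at least [n] by [guv]. *)
have [b b0d gb] : exists2 b, b \in `[0, d]%R & `|v + b *: (v - u)| = n.
  apply: IVT; first exact: ltW.
    by apply: continuous_subspaceT; exact: continuous_norm_extend.
  rewrite scale0r addr0 hv ge_min n1 /= le_max.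
  by rewrite /n guv orbT.
move: b0d; rewrite in_itv/= => /andP[b0 bd].
have nb : n <= 1 + b * J.
  by rewrite -gb -[X in _ <= X + _]hv -vuJ norm_extend_le.
have n0 : 0 < n by lra.
pose x := u + d *: (u - v); pose y := v + b *: (v - u).
have xB : x - y = (1 + d + b) *: (u - v).
  rewrite /x /y -(opprB u v) scalerN opprD opprK addrACA.
  by rewrite !scalerDl scale1r addrA.
(* The opposite pushes partly cancel in the sum, leaving a shift by [(d - b) *: (u - v)]. *)
have xD : `|u + v| <= `|x + y| + (d - b) * J.
  rewrite -[X in _ + X * _]ger0_norm ?subr_ge0// -uvJ -normrZ.
  rewrite (_ : u + v = x + y - (d - b) *: (u - v)) ?ler_normB//.
  rewrite /x /y -(opprB u v) scalerN addrACA -scalerBl.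
  by rewrite addrK.
exists (n^-1 *: x), (n^-1 *: y); split.
- by rewrite normrZ gtr0_norm ?invr_gt0// mulVf// gt_eqF.
- by rewrite normrZ gtr0_norm ?invr_gt0// gb mulVf// gt_eqF.
rewrite -scalerDr -scalerBr !normrZ gtr0_norm ?invr_gt0// !(mulrC n^-1).
rewrite lt_min !ltr_pdivlMr//; apply/andP; split; last first.
  rewrite xB normrZ gtr0_norm; last by lra.
  rewrite uvJ mulrC ltr_pM2r//; nra.
have Jn : J * n <= J + 4 * d by nra.
have bJ : (d - b) * J <= 2 * d by nra.
lra.
Qed.

Theorem theorem2p7 (R : realType) (X : normedModType R)
    (dimX : dim_ge X 2) (u v : X)
    (hu : unit_sphere X u) (hv : unit_sphere X v)
    (huv : Num.min `|u - v| `|u + v| = james_constant X) :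
  isosceles_orthogonal u v.
Proof.
have J0 := james_constant_gt0 _ _ dimX.
have not_lt w : `|w| = 1 -> Num.min `|u - w| `|u + w| = james_constant X ->
    ~~ (`|u - w| < `|u + w|).
  move=> hw huw; apply/negP => lt_uw.
  move: huw; rewrite (min_l (ltW lt_uw)) => huw.
  have [|x [y [hx hy]]] := spread_unit_vectors _ _ _ _ hu hw.
    by rewrite lt_uw huw J0.
  by rewrite huw ltNge min_le_james_constant.
rewrite /isosceles_orthogonal; apply/eqP; rewrite eq_le !leNgt not_lt//=.
(* Replacing [v] by [- v] swaps sum and difference, which excludes the other strict inequality. *)
by have := not_lt (- v); rewrite opprK normrN minC; exact.
Qed.
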